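(* Let $M$ be a smooth manifold. A $^*$-ideal $\mathcal I$ in $C^\infty(M)$ is closed in the algebraic sense (i.e. it is the kernel of a $^*$-representation of $C^\infty(M)$ on a complex pre-Hilbert space) if and only if it is closed with respect to the (weak) $C^0$-topology.
   Context: $C^\infty(M)$ is the $^*$-algebra over $\mathbb C$ of complex-valued smooth functions on a finite-dimensional smooth manifold $M$ (not assumed compact), with complex conjugation as $^*$-involution. A $^*$-ideal is an ideal closed under the involution. A complex pre-Hilbert space is a complex vector space $\mathfrak H$ with a positive-definite Hermitian product ($\mathfrak H=0$ allowed); $\mathfrak B(\mathfrak H)$ is the $^*$-algebra of all linear maps $\mathfrak H\to\mathfrak H$ having an adjoint on $\mathfrak H$. A $^*$-representation is a $^*$-homomorphism into $\mathfrak B(\mathfrak H)$. The (weak) $C^0$-topology on $C^\infty(M)$ is the locally convex topology defined by the seminorms $\rho_K(f)=\sup_{x\in K}|f(x)|$, $K\subseteq M$ compact. *)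

(* Defs.v *)
From HB Require Import structures.
From mathcomp Require Import all_boot all_order all_algebra.
From mathcomp Require Import all_classical all_reals all_analysis.
From mathcomp Require Import complex.

Set Implicit Arguments.
Unset Strict Implicit.
Unset Printing Implicit Defensive.

Import Order.TTheory GRing.Theory Num.Theory.
Import numFieldNormedType.Exports.

Local Open Scope classical_set_scope.
Local Open Scope ring_scope.

Section SmoothEuclidean.
Variables (R : realType) (n : nat).
Implicit Types (V : set 'rV[R]_n) (f g : 'rV[R]_n -> R) (k : nat).

(* Real functions all of whose iterated partial derivatives of order at most k
   exist and are continuous on V; only meaningful for V open. *)
Fixpoint Ck_on V k f : Prop :=
  {in V, continuous f} /\
  if k is k'.+1 then
    forall i : 'I_n,
      {in V, forall x, derivable f x (delta_mx 0 i)} /\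
      Ck_on V k' (fun x => 'D_(delta_mx 0 i) f x)
  else True.

Definition smooth_on V f := forall k, Ck_on V k f.

Definition smooth_map_on m V (F : 'rV[R]_n -> 'rV[R]_m) :=
  forall j : 'I_m, smooth_on V (fun x => F x 0 j).

Definition csmooth_on V (F : 'rV[R]_n -> R[i]) :=
  smooth_on V (fun x => complex.Re (F x)) /\
  smooth_on V (fun x => complex.Im (F x)).

Lemma Ck_on_continuous V k f : Ck_on V k f -> {in V, continuous f}.
Proof. by case: k => [|k] []. Qed.

Lemma Ck_onW V k f : Ck_on V k.+1 f -> Ck_on V k f.
Proof.
elim: k f => [|k IHk] f [cf df]; first by split.
by split=> // i; have [dfi Dfi] := df i; split=> //; exact: IHk.
Qed.

Lemma eq_Ck_on V k f g :
  open V -> {in V, f =1 g} -> Ck_on V k f -> Ck_on V k g.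
Proof.
move=> oV; have nearV (u v : 'rV[R]_n -> R) x : {in V, u =1 v} -> x \in V ->
    {near x, u =1 v}.
  move=> uv /set_mem Vx; have : nbhs x V by exact: open_nbhs_nbhs.
  by apply: filterS => y /mem_set /uv.
elim: k f g => [|k IHk] f g fg [cf df].
  by split=> // x Vx; rewrite /continuous_at -(fg x Vx);
    apply: cvg_trans (cf x Vx); exact: near_eq_cvg (nearV _ _ _ fg Vx).
split=> [x Vx|i].
  by rewrite /continuous_at -(fg x Vx);
    apply: cvg_trans (cf x Vx); exact: near_eq_cvg (nearV _ _ _ fg Vx).
have [dfi Dfi] := df i.
have e0 : (delta_mx 0 i : 'rV[R]_n) != 0.
  apply/eqP => /matrixP /(_ 0 i) /eqP.
  by rewrite !mxE !eqxx oner_eq0.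
split=> [x Vx|].
  apply: (near_eq_derivable _ (dfi x Vx)) => //; exact: nearV.
apply: IHk Dfi => x Vx.
by apply: near_eq_derive => //; exact: nearV.
Qed.

Lemma Ck_on_cst V k (c : R) : open V -> Ck_on V k (fun=> c).
Proof.
move=> oV; elim: k c => [|k IHk] c; first by split=> // x _; exact: cst_continuous.
split=> [x _|i]; first exact: cst_continuous.
split=> [x _|]; first exact: derivable_cst.
by apply: eq_Ck_on (IHk 0) => // x _; rewrite (derive_cst c).
Qed.

Lemma Ck_onD V k f g :
  open V -> Ck_on V k f -> Ck_on V k g -> Ck_on V k (f + g).
Proof.
move=> oV; elim: k f g => [|k IHk] f g [cf df] [cg dg].
  by split=> // x Vx; apply: continuousD; [exact: cf|exact: cg].
split=> [x Vx|i]; first by apply: continuousD; [exact: cf|exact: cg].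
have [dfi Dfi] := df i; have [dgi Dgi] := dg i.
split=> [x Vx|]; first by apply: derivableD; [exact: dfi|exact: dgi].
apply: eq_Ck_on (IHk _ _ Dfi Dgi) => // x Vx.
by rewrite deriveD //; [exact: dfi|exact: dgi].
Qed.

Lemma Ck_onM V k f g :
  open V -> Ck_on V k f -> Ck_on V k g -> Ck_on V k (f * g).
Proof.
move=> oV; elim: k f g => [|k IHk] f g.
  by move=> [cf _] [cg _]; split=> // x Vx; apply: continuousM;
    [exact: cf|exact: cg].
move=> /[dup] /Ck_onW Cf [cf df] /[dup] /Ck_onW Cg [cg dg].
split=> [x Vx|i]; first by apply: continuousM; [exact: cf|exact: cg].
have [dfi Dfi] := df i; have [dgi Dgi] := dg i.
split=> [x Vx|]; first by apply: derivableM; [exact: dfi|exact: dgi].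
apply: eq_Ck_on (Ck_onD oV (IHk _ _ Cf Dgi) (IHk _ _ Cg Dfi)) => // x Vx.
by rewrite deriveM //; [exact: dfi|exact: dgi].
Qed.

Lemma smooth_on_cst V (c : R) : open V -> smooth_on V (fun=> c).
Proof. by move=> oV k; exact: Ck_on_cst. Qed.

Lemma smooth_onD V f g :
  open V -> smooth_on V f -> smooth_on V g -> smooth_on V (f + g).
Proof. by move=> oV Cf Cg k; exact: Ck_onD. Qed.

Lemma smooth_onM V f g :
  open V -> smooth_on V f -> smooth_on V g -> smooth_on V (f * g).
Proof. by move=> oV Cf Cg k; exact: Ck_onM. Qed.

Lemma smooth_onN V f : open V -> smooth_on V f -> smooth_on V (- f).
Proof.
move=> oV Cf; have -> : - f = (fun=> -1) * f.
  by apply/funext => x; rewrite /GRing.mul/= mulN1r.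
exact: smooth_onM (smooth_on_cst _ oV) Cf.
Qed.

End SmoothEuclidean.

Section Manifold.
Variables (R : realType) (n : nat).

(* A homeomorphism between the open sets chart_dom of M and chart_cod of R^n,
   given by total maps that are only meaningful on these sets. *)
Record chart (M : topologicalType) := Chart {
  chart_dom : set M ;
  chart_cod : set 'rV[R]_n ;
  chart_map : M -> 'rV[R]_n ;
  chart_inv : 'rV[R]_n -> M ;
  chart_dom_open : open chart_dom ;
  chart_cod_open : open chart_cod ;
  chart_map_fun : {homo chart_map : x / chart_dom x >-> chart_cod x} ;
  chart_inv_fun : {homo chart_inv : y / chart_cod y >-> chart_dom y} ;
  chart_mapK : {in chart_dom, cancel chart_map chart_inv} ;
  chart_invK : {in chart_cod, cancel chart_inv chart_map} ;
  chart_map_continuous : {in chart_dom, continuous chart_map} ;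
  chart_inv_continuous : {in chart_cod, continuous chart_inv}
}.

(* The smooth structure is given by an atlas, not required to be maximal. *)
Record smooth_manifold := SmoothManifold {
  manifold_space :> topologicalType ;
  manifold_hausdorff : hausdorff_space manifold_space ;
  manifold_second_countable : @second_countable manifold_space ;
  manifold_atlas : set (chart manifold_space) ;
  manifold_atlas_cover :
    forall x, exists2 c, manifold_atlas c & chart_dom c x ;
  manifold_atlas_compatible : forall c d,
    manifold_atlas c -> manifold_atlas d ->
    smooth_map_on (chart_cod c `&` chart_inv c @^-1` chart_dom d)
      (chart_map d \o chart_inv c)
}.

End Manifold.

Section SmoothFunctions.
Variables (R : realType) (n : nat) (M : smooth_manifold R n).
Implicit Types f g : M -> R[i].

Definition is_smooth f := forall c : chart R n M, manifold_atlas c ->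
  csmooth_on (chart_cod c) (f \o chart_inv c).

Record smooth_fun := SmoothFun {
  smooth_val :> M -> R[i] ;
  smooth_valP : `[< is_smooth smooth_val >]
}.

HB.instance Definition _ := [isSub for smooth_val].
HB.instance Definition _ := [Choice of smooth_fun by <:].

Lemma is_smooth_cst (a : R[i]) : is_smooth (fun=> a).
Proof.
by move=> c _; split; apply: smooth_on_cst; exact: chart_cod_open.
Qed.

Lemma is_smoothD f g : is_smooth f -> is_smooth g -> is_smooth (f + g).
Proof.
move=> sf sg c Ac; have [fr fi] := sf c Ac; have [gr gi] := sg c Ac.
have oc : open (chart_cod c) by exact: chart_cod_open.
split.
- have -> : (fun x => complex.Re (((f + g) \o chart_inv c) x)) =
    (fun x => complex.Re ((f \o chart_inv c) x)) +
    (fun x => complex.Re ((g \o chart_inv c) x)).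
    by apply/funext => x; exact: raddfD.
  exact: smooth_onD.
- have -> : (fun x => complex.Im (((f + g) \o chart_inv c) x)) =
    (fun x => complex.Im ((f \o chart_inv c) x)) +
    (fun x => complex.Im ((g \o chart_inv c) x)).
    by apply/funext => x; exact: raddfD.
  exact: smooth_onD.
Qed.

Lemma is_smoothM f g : is_smooth f -> is_smooth g -> is_smooth (f * g).
Proof.
move=> sf sg c Ac; have [fr fi] := sf c Ac; have [gr gi] := sg c Ac.
have oc : open (chart_cod c) by exact: chart_cod_open.
pose fR x := complex.Re ((f \o chart_inv c) x).
pose fI x := complex.Im ((f \o chart_inv c) x).
pose gR x := complex.Re ((g \o chart_inv c) x).
pose gI x := complex.Im ((g \o chart_inv c) x).
split.
- have -> : (fun x => complex.Re (((f * g) \o chart_inv c) x)) =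
    fR * gR + - (fI * gI).
    apply/funext => x.
    rewrite /GRing.mul /GRing.add /GRing.opp/= /fR /fI /gR /gI/=.
    by case: (f _) => ? ?; case: (g _).
  by apply: smooth_onD => //; [|apply: smooth_onN => //]; exact: smooth_onM.
- have -> : (fun x => complex.Im (((f * g) \o chart_inv c) x)) =
    fR * gI + fI * gR.
    apply/funext => x; rewrite /GRing.mul /GRing.add/= /fR /fI /gR /gI/=.
    by case: (f _) => ? ?; case: (g _).
  by apply: smooth_onD => //; exact: smooth_onM.
Qed.

Lemma is_smooth_conj f : is_smooth f -> is_smooth (fun x => (f x)^*%C).
Proof.
move=> sf c Ac; have [fr fi] := sf c Ac.
have oc : open (chart_cod c) by exact: chart_cod_open.
split.
- have -> : (fun x => complex.Re (((fun y => (f y)^*%C) \o chart_inv c) x)) =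
    (fun x => complex.Re ((f \o chart_inv c) x)).
    by apply/funext => x /=; case: (f _).
  by [].
- have -> : (fun x => complex.Im (((fun y => (f y)^*%C) \o chart_inv c) x)) =
    - (fun x => complex.Im ((f \o chart_inv c) x)).
    by apply/funext => x; rewrite /GRing.opp/=; case: (f _).
  exact: smooth_onN.
Qed.

Definition smooth_pred : {pred M -> R[i]} := fun f => `[< is_smooth f >].

Lemma smooth_subring_closed : subring_closed smooth_pred.
Proof.
split.
- by apply/asboolP; exact: is_smooth_cst.
- move=> f g /asboolP sf /asboolP sg; apply/asboolP.
  apply: is_smoothD => //.
  have -> : - g = (fun=> -1) * g by rewrite -[LHS]mulN1r.
  exact: is_smoothM (is_smooth_cst _) sg.
- by move=> f g /asboolP sf /asboolP sg; apply/asboolP; exact: is_smoothM.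
Qed.

HB.instance Definition _ :=
  GRing.SubChoice_isSubComPzRing.Build (M -> R[i]) smooth_pred smooth_fun
    smooth_subring_closed.

Lemma smooth_subsemimod_closed : subsemimod_closed smooth_pred.
Proof.
have sZ : GRing.scaler_closed smooth_pred.
  move=> a f /asboolP sf; apply/asboolP.
  exact: (is_smoothM (is_smooth_cst a) sf).
split=> //; split.
  by apply/asboolP; exact: is_smooth_cst.
by move=> f g /asboolP sf /asboolP sg; apply/asboolP; exact: is_smoothD.
Qed.

HB.instance Definition _ :=
  GRing.SubZmodule_isSubLmodule.Build R[i] (M -> R[i]) smooth_pred smooth_fun
    smooth_subsemimod_closed.

(* The library's algebra structures require a nonzero ring, which smooth_fun is
   not when M is empty. *)
Lemma smooth_scalerAl (a : R[i]) (f g : smooth_fun) : a *: (f * g) = a *: f * g.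
Proof.
apply: val_inj; apply/funext => x.
exact: mulrA.
Qed.

Definition smooth_conj (f : smooth_fun) : smooth_fun :=
  SmoothFun (asboolT (is_smooth_conj (asboolW (smooth_valP f)))).

Record star_ideal (I : set smooth_fun) : Prop := StarIdeal {
  star_ideal0 : I 0 ;
  star_idealD : forall f g : smooth_fun, I f -> I g -> I (f + g) ;
  star_idealM : forall f g : smooth_fun, I g -> I (f * g) ;
  star_ideal_conj : forall f : smooth_fun, I f -> I (smooth_conj f)
}.

(* For K empty this is sup set0 = 0. *)
Definition C0_seminorm (K : set M) (f : smooth_fun) : R :=
  sup [set complex.Re `|f x| | x in K].

(* Open sets of the locally convex topology defined by the seminorms
   C0_seminorm K for K compact. *)
Definition C0_open (U : set smooth_fun) := forall f : smooth_fun, U f ->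
  exists (F : set (set M)) (e : R),
    [/\ finite_set F, F `<=` compact, 0 < e &
      forall g : smooth_fun, (forall K, F K -> C0_seminorm K (g - f) < e) -> U g].

Lemma C0_openT : C0_open setT.
Proof. by move=> f _; exists set0, 1; split. Qed.

Lemma C0_openI : setI_closed C0_open.
Proof.
move=> U V oU oV f [Uf Vf].
have [F [d [finF cF d0 FU]]] := oU f Uf.
have [G [e [finG cG e0 GV]]] := oV f Vf.
exists (F `|` G), (Num.min d e); split.
- by rewrite finite_setU.
- by move=> K [/cF|/cG].
- by rewrite lt_min d0.
- move=> g FGg; split; [apply: FU => K FK|apply: GV => K GK].
  + by have := FGg K (or_introl FK); rewrite lt_min => /andP[].
  + by have := FGg K (or_intror GK); rewrite lt_min => /andP[].
Qed.

Lemma C0_open_bigU (J : Type) (U : J -> set smooth_fun) :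
  (forall j, C0_open (U j)) -> C0_open (\bigcup_j U j).
Proof.
move=> oU f [j _ Ujf]; have [F [e [finF cF e0 FU]]] := oU j f Ujf.
by exists F, e; split=> // g Fg; exists j => //; exact: FU.
Qed.

HB.instance Definition _ := isOpenTopological.Build smooth_fun
  C0_openT C0_openI C0_open_bigU.

End SmoothFunctions.

Section Representations.
Variables (R : realType) (n : nat) (M : smooth_manifold R n).

Section PreHilbert.
Variables (H : lmodType R[i]) (dot : {dot H for @conjc R}).

Definition is_adjoint (S T : H -> H) := forall u v, dot (S u) v = dot u (T v).

Definition adjointable (S : H -> H) :=
  linear S /\ exists2 T, linear T & is_adjoint S T.

(* Adjoints are unique, so star_rep_conj says that the operator of the complex
   conjugate of f is the adjoint of the operator of f. *)
Record star_rep (op : smooth_fun M -> H -> H) : Prop := StarRep {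
  star_rep_adjointable : forall f, adjointable (op f) ;
  star_rep_linear : linear op ;
  star_repM : forall f g, op (f * g) = op f \o op g ;
  star_rep_conj : forall f, is_adjoint (op f) (op (smooth_conj f))
}.

End PreHilbert.

Definition star_rep_kernel (I : set (smooth_fun M)) :=
  exists (H : lmodType R[i]) (dot : {dot H for @conjc R})
         (op : smooth_fun M -> H -> H),
    star_rep dot op /\ I = [set f | op f = 0].

End Representations.

(* Main.v *)
(* A closed *-ideal I is the ideal of functions vanishing on its zero set Z: if f
   vanishes on Z and K is compact, some h >= 0 in I exceeds 1 wherever f is not
   small on K, so that with C >= h on K the functions f (1 - h / C)^m, which are
   congruent to f modulo I, tend to be small on K. The functions vanishing on Z
   are the kernel of the action by multiplication on finitely supported functions
   on a countable dense subset of Z.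

   Conversely, let v be a vector of a *-representation. The functional
   w(f) = <f v, v> is nonnegative on nonnegative f, since f + e is a square for
   e > 0. It is also C0-continuous, i.e. bounded on the functions that are small
   on a suitable compact set: otherwise there are f_i >= 0, small on the i-th
   compact set of an exhaustion, with w(f_i) > 1; composing them with a smooth
   function that kills small values gives a locally finite family whose sum G is
   smooth and has w(G) larger than every natural number. Hence if g in the kernel
   approximates f, then |f v|^2 = w(|f - g|^2) is small. *)
From HB Require Import structures.
Require Import Defs.
From mathcomp Require Import all_boot all_order all_algebra.
From mathcomp Require Import all_classical all_reals all_analysis.
From mathcomp Require Import complex.
From mathcomp Require Import ring lra.

Set Implicit Arguments.
Unset Strict Implicit.
Unset Printing Implicit Defensive.

Import Order.TTheory GRing.Theory Num.Theory.
Import numFieldNormedType.Exports.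

Local Open Scope classical_set_scope.
Local Open Scope ring_scope.

(** * Composition with functions of one real variable *)

Section ScalarCalculus.
Variable R : realType.

(** Restricting to the line [h *: v + x] turns the directional derivative into an ordinary one at 0,
    where the one-variable chain rule applies. *)
Lemma is_derive_comp1 (V : normedModType R) (t : R -> R) (g : V -> R)
    (x v : V) (a b : R) :
  is_derive (g x) (1 : R) t a -> is_derive x v g b -> is_derive x v (t \o g) (a * b).
Proof.
move=> dt [dg gb]; pose l := fun h : R => g (h *: v + x).
have l0 : l 0 = g x by rewrite /l scale0r add0r.
have dirE (f : V -> R) : 'D_v f x = 'D_1 (fun h : R => f (h *: v + x)) 0.
  rewrite /derive; set g1 := fun h => h^-1 *: _; set g2 := fun h => h^-1 *: _.
  suff -> : g1 = g2 by [].
  by apply/funext => h; rewrite /g1 /g2 /= addr0 scale0r add0r [_%:A]mulr1.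
have dl : is_derive (0 : R) (1 : R) l b.
  by apply: DeriveDef; [exact: (derivable1P g x v).1|rewrite -dirE].
have [dtl tl] : is_derive (0 : R) (1 : R) (t \o l) (a * b).
  by apply: is_derive1_comp; rewrite l0.
by apply: DeriveDef; [exact: (derivable1P (t \o g) x v).2|rewrite dirE].
Qed.

(* The family t is closed under derivation, the derivative of t j being t (d j). *)
Lemma Ck_on_comp n (V : set 'rV[R]_n) (S : set R) (J : Type)
    (t : J -> R -> R) (d : J -> J) (g : 'rV[R]_n -> R) k j :
  open V -> (forall j x, S x -> is_derive x (1 : R) (t j) (t (d j) x)) ->
  (forall x, V x -> S (g x)) -> smooth_on V g -> Ck_on V k (t j \o g).
Proof.
move=> oV dt VS sg.
have ct j' : {in V, continuous (t j' \o g)}.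
  move=> x Vx; apply: continuous_comp; first exact: Ck_on_continuous (sg 0) _ _.
  apply/differentiable_continuous/derivable1_diffP.
  by have [] := dt j' (g x) (VS _ (set_mem Vx)).
elim: k j => [|k IHk] j; split => // i.
have dtg x : x \in V -> is_derive x (delta_mx 0 i) (t j \o g)
    (t (d j) (g x) * 'D_(delta_mx 0 i) g x).
  move=> Vx; apply: is_derive_comp1; first exact/dt/VS/set_mem.
  apply: derivableP; have [_ dg] := sg 1.
  by have [+ _] := dg i; apply.
split=> [x /dtg[]//|].
apply: (@eq_Ck_on _ _ _ _
  ((t (d j) \o g) * (fun x => 'D_(delta_mx 0 i) g x))) => //.
  by move=> x Vx; have [_ ->] := dtg x Vx.
apply: Ck_onM => //.
by have [_ dg] := sg k.+1; have [] := dg i.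
Qed.

(** Derivatives depend only on germs. The function [g] may vary with the point, as happens for the
    partial sums of a locally finite family. *)
Lemma near_eq_Ck_on n (V : set 'rV[R]_n) k f :
  (forall x, V x -> exists2 g, Ck_on V k g & \forall y \near x, f y = g y) ->
  Ck_on V k f.
Proof.
have nearC (u w : 'rV[R]_n -> R) (x : 'rV[R]_n) :
    (\forall y \near x, u y = w y) -> \forall y \near x, w y = u y.
  by apply: filterS => y ->.
have near_ct (u w : 'rV[R]_n -> R) (x : 'rV[R]_n) : w y @[y --> x] --> w x ->
    (\forall y \near x, u y = w y) -> u y @[y --> x] --> u x.
  move=> cw uw; rewrite (nbhs_singleton uw).
  by apply: cvg_trans cw; exact: near_eq_cvg (nearC _ _ _ uw).
elim: k f => [|k IHk] f fg.
  split=> // x /set_mem Vx; have [g [cg _] nfg] := fg x Vx.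
  exact: near_ct (cg x (mem_set Vx)) nfg.
split=> [x /set_mem Vx|i].
  have [g [cg _] nfg] := fg x Vx; exact: near_ct (cg x (mem_set Vx)) nfg.
split=> [x /set_mem Vx|].
  have [g [_ dg] nfg] := fg x Vx; have [{}dg _] := dg i.
  exact: near_eq_derivable (nearC _ _ _ nfg) (dg x (mem_set Vx)).
apply: IHk => x Vx; have [g [_ dg] nfg] := fg x Vx; have [_ {}dg] := dg i.
exists (fun y => 'D_(delta_mx 0 i) g y) => //.
(* The induction needs the derivatives to agree near [x], not only at [x]: [f] and [g] agree near
   every [y] close to [x]. *)
move/nbhs_interior: nfg; apply: filterS => y fgy.
exact: near_eq_derive.
Qed.

(* Functions of this form are closed under derivation, also at 0. *)
Definition flat (p : {poly R}) (x : R) :=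
  if 0 < x then p.[x^-1] * expR (- x^-1) else 0.

Lemma flat_pos p x : 0 < x -> flat p x = p.[x^-1] * expR (- x^-1).
Proof. by rewrite /flat => ->. Qed.

Lemma flat_neg p x : x <= 0 -> flat p x = 0.
Proof. by rewrite /flat ltNge => ->. Qed.

(** Each monomial satisfies [y ^+ k * expR (- y) <= k!], because the exponential series dominates
    its k-th term. *)
Lemma horner_expRN_bounded (p : {poly R}) :
  exists C : R, forall y, 0 <= y -> `|p.[y] * expR (- y)| <= C.
Proof.
have mono k (y : R) : 0 <= y -> y ^+ k * expR (- y) <= k`!%:R.
  move=> y0; rewrite expRN ler_pdivrMr ?expR_gt0//.
  case: k => [|k]; first by rewrite expr0 fact0 mul1r -expR0 ler_expR.
  rewrite mulrC -ler_pdivrMr ?ltr0n ?fact_gt0//.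
  by apply: le_trans (expR_ge1Dxn k y0); rewrite lerDr.
exists (\sum_(i < size p) `|p`_i| * i`!%:R) => y y0.
rewrite horner_coef mulr_suml; apply: le_trans (ler_norm_sum _ _ _) _.
apply: ler_sum => i _; rewrite -mulrA normrM ler_wpM2l//.
by rewrite ger0_norm ?mono// mulr_ge0 ?exprn_ge0 ?expR_ge0.
Qed.

Lemma is_derive_flat p x : is_derive x (1 : R) (flat p) (flat ('X^2 * (p - p^`())) x).
Proof.
have [x0|x0|<-] := ltgtP 0 x.
- have x1 : x^-1 != 0 by rewrite invr_eq0 gt_eqF.
  apply: (@near_eq_is_derive _ _ _ (fun y : R => p.[y^-1] * expR (- y^-1))).
    by near=> y; rewrite flat_pos//; near: y; exact: lt_nbhsr.
  rewrite flat_pos//.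
  have dV : is_derive x (1 : R) (fun y : R => y^-1) (- x ^- 2).
    by have := @is_deriveV _ id x 1 1; rewrite /GRing.scale/= mulr1; apply;
      rewrite ?gt_eqF//; exact: is_derive_id.
  have dp := is_derive_comp1 (is_derive_poly p x^-1) dV.
  have de := @is_derive_comp1 _ expR (fun y : R => - y^-1) x 1 _ _
    (is_derive_expR (- x^-1)) (is_deriveN dV).
  rewrite [X in is_derive _ _ X](_ : _ =
    (horner p \o GRing.inv) * (expR \o (fun y : R => - y^-1))); last exact/funext.
  apply: (is_derive_eq (is_deriveM dp de)).
  rewrite /= /GRing.scale/= hornerM hornerXn hornerD hornerN exprVn.
  by ring.
- apply: (@near_eq_is_derive _ _ _ (cst 0)).
    by near=> y; rewrite flat_neg//; apply/ltW; near: y; exact: lt_nbhsl.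
  rewrite flat_neg ?ltW//; exact: is_derive_cst.
rewrite flat_neg//.
(* The extra factor ['X^2] gives [|flat p h| <= C * h^2], so the difference quotient at 0 is at most
   [C * |h|]. *)
have [C pC] := horner_expRN_bounded ('X^2 * p).
have C0 : 0 <= C by apply: le_trans (pC 0 _).
suff flat0 : (fun h : R => h^-1 *: ((flat p \o shift 0) (h *: (1 : R)) - flat p 0)) @ 0^'
    --> (0 : R).
  apply: DeriveDef; first by apply/cvg_ex; exists 0.
  exact: cvg_lim flat0.
apply/norm_cvg0P; apply: (@squeeze_cvgr _ _ _ _ (cst 0) (fun h : R => C * `|h|)).
- near=> h; rewrite normr_ge0/= addr0 (flat_neg p (lexx 0)) subr0 /GRing.scale/= mulr1.
  have [h0|h0] := leP h 0; first by rewrite flat_neg// mulr0 normr0 mulr_ge0.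
  have hV : 0 <= h^-1 by rewrite invr_ge0 ltW.
  rewrite flat_pos// -[leRHS]mulrC -ler_pdivrMl ?normr_gt0 ?gt_eqF//.
  apply: le_trans (pC _ hV); rewrite hornerM hornerXn -normfV -normrM.
  by rewrite expr2 !mulrA.
- exact: cvg_cst.
rewrite -[X in _ --> X](mulr0 C); apply: cvgMr.
rewrite -[X in _ --> X](normr0 R); apply: cvg_norm.
exact: nbhs_dnbhs.
Unshelve. all: by end_near.
Qed.

End ScalarCalculus.

(** * Smooth functions on a manifold *)

Section SmoothCalculus.
Variables (R : realType) (n : nat) (M : smooth_manifold R n).
Implicit Types (f g h : smooth_fun M) (r : M -> R) (x y : M).

Definition rsmooth r := forall c : chart R n M, manifold_atlas c ->
  smooth_on (chart_cod c) (r \o chart_inv c).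

Lemma smooth_funP f : is_smooth f.
Proof. exact: asboolW (smooth_valP f). Qed.

Lemma smooth_fun_ext f g : (forall x, f x = g x) -> f = g.
Proof. by move=> fg; apply/val_inj/funext. Qed.

Lemma smooth_fun0E x : (0 : smooth_fun M) x = 0. Proof. by []. Qed.
Lemma smooth_fun1E x : (1 : smooth_fun M) x = 1. Proof. by []. Qed.
Lemma smooth_funDE f g x : (f + g) x = f x + g x. Proof. by []. Qed.
Lemma smooth_funNE f x : (- f) x = - f x. Proof. by []. Qed.
Lemma smooth_funME f g x : (f * g) x = f x * g x. Proof. by []. Qed.
Lemma smooth_funZE (a : R[i]) f x : (a *: f) x = a * f x. Proof. by []. Qed.
Lemma smooth_conjE f x : smooth_conj f x = (f x)^*%C. Proof. by []. Qed.

Lemma smooth_fun_sumE (I : Type) (s : seq I) (P : pred I) (F : I -> smooth_fun M) x :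
  (\sum_(i <- s | P i) F i) x = \sum_(i <- s | P i) F i x.
Proof. by apply: (big_morph (fun f : smooth_fun M => f x)). Qed.

Definition smooth_funE := (smooth_fun_sumE, smooth_fun0E, smooth_fun1E,
  smooth_funDE, smooth_funNE, smooth_funME, smooth_funZE, smooth_conjE).

Lemma rsmooth_Re f : rsmooth (fun x => complex.Re (f x)).
Proof. by move=> c Ac; have [] := smooth_funP f Ac. Qed.

Lemma rsmooth_Im f : rsmooth (fun x => complex.Im (f x)).
Proof. by move=> c Ac; have [] := smooth_funP f Ac. Qed.

Lemma rsmooth_is_smooth r : rsmooth r -> is_smooth (fun x => (r x)%:C%C).
Proof.
move=> sr c Ac; split; first exact: sr.
by apply: smooth_on_cst; exact: chart_cod_open.
Qed.

Definition smooth_of_real r (sr : rsmooth r) : smooth_fun M :=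
  SmoothFun (asboolT (rsmooth_is_smooth sr)).

Lemma smooth_of_realE r (sr : rsmooth r) x : smooth_of_real sr x = (r x)%:C%C.
Proof. by []. Qed.

Lemma rsmooth_comp (S : set R) (J : Type) (t : J -> R -> R) (d : J -> J) r j :
  (forall (k : J) (s : R), S s -> is_derive s (1 : R) (t k) (t (d k) s)) ->
  (forall x, S (r x)) -> rsmooth r -> rsmooth (t j \o r).
Proof.
move=> dt Sr sr c Ac k.
change (Ck_on (chart_cod c) k (t j \o (r \o chart_inv c))).
apply: (Ck_on_comp _ _ _ dt); first exact: chart_cod_open.
  by move=> y _; exact: Sr.
exact: sr.
Qed.

Lemma rsmooth_continuous r : rsmooth r -> continuous r.
Proof.
move=> sr x; have [c Ac cx] := manifold_atlas_cover x.
have nc : \forall y \near x, chart_dom c y.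
  by apply: open_nbhs_nbhs; split=> //; exact: chart_dom_open.
have rE : \forall y \near x, ((r \o chart_inv c) \o chart_map c) y = r y.
  by apply: filterS nc => y cy /=; rewrite chart_mapK ?inE.
have cr : {for x, continuous ((r \o chart_inv c) \o chart_map c)}.
  apply: continuous_comp; first by apply: chart_map_continuous; rewrite inE.
  by apply: (Ck_on_continuous (sr c Ac 0)); rewrite inE; exact: chart_map_fun.
rewrite /continuous_at -(nbhs_singleton rE).
exact: cvg_trans (near_eq_cvg rE) cr.
Qed.

Lemma ge0_smooth_fun f x : 0 <= f x -> f x = (complex.Re (f x))%:C%C.
Proof. by move=> /ger0_Im; case: (f x) => a b /= ->. Qed.

Lemma smooth_fun_sqrt f : (forall x, 0 < f x) ->
  (* The pair [(a, b)] encodes [a * s ^ b], whose derivative [a * b * s ^ (b - 1)] stays in the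
     family for [s > 0]; the square root is [(1, 2^-1)]. *)
  exists g, f = smooth_conj g * g.
Proof.
move=> f0; pose t (p : R * R) (s : R) := p.1 * s `^ p.2.
pose d (p : R * R) := (p.1 * p.2, p.2 - 1).
have f0R x : 0 < complex.Re (f x) by have := f0 x; rewrite ltcE => /andP[].
have sg : rsmooth (t (1, 2^-1) \o (fun x => complex.Re (f x))).
  apply: (@rsmooth_comp [set s | 0 < s] _ t d) => //; last exact: rsmooth_Re.
  move=> [a b] s s0; rewrite /t/= -mulrA.
  exact: is_deriveZ (is_derive1_powR b s0).
exists (smooth_of_real sg); apply: smooth_fun_ext => x.
rewrite ge0_smooth_fun ?ltW// smooth_funME smooth_conjE !smooth_of_realE conjc_real /t/= mul1r.
by rewrite powR12_sqrt ?ltW// -rmorphM/= -expr2 sqr_sqrtr ?ltW.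
Qed.

(* Take g = phi (f / e) e with phi s = exp(1) s exp(- 1 / (s - 1)) for s > 1 and
   phi s = 0 for s <= 1, so that phi s >= s - 2. *)
Lemma smooth_fun_cutoff f (e : R) : 0 < e -> (forall x, 0 <= f x) ->
  exists g, [/\ forall x, 0 <= g x, forall x, complex.Re (f x) < e -> g x = 0 &
    forall x, f x - (2 * e)%:C%C <= g x].
Proof.
move=> e0 f0; have f0R x : 0 <= complex.Re (f x).
  by have := f0 x; rewrite lecE => /andP[].
have [u uE] : exists u : smooth_fun M, forall x, u x = (e^-1 * complex.Re (f x) - 1)%:C%C.
  exists ((e^-1)%:C%C *: f - 1) => x.
  by rewrite !smooth_funE [f x in LHS]ge0_smooth_fun// rmorphB rmorphM.
have sg : rsmooth (flat 1 \o (fun x => complex.Re (u x))).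
  apply: (@rsmooth_comp setT _ (@flat R) (fun p => 'X^2 * (p - p^`()))) => //.
    by move=> p s _; exact: is_derive_flat.
  exact: rsmooth_Re.
exists ((expR 1)%:C%C *: (f * smooth_of_real sg)).
have gE x : ((expR 1)%:C%C *: (f * smooth_of_real sg)) x =
    (expR 1 * (complex.Re (f x) * flat 1 (e^-1 * complex.Re (f x) - 1)))%:C%C.
  rewrite !smooth_funE !smooth_of_realE /= uE/= [f x in LHS]ge0_smooth_fun//.
  by rewrite -!rmorphM.
have flat0 s : 0 <= flat (1 : {poly R}) s.
  by rewrite /flat; case: ifP => // _; rewrite hornerC mul1r expR_ge0.
split=> x.
- by rewrite gE ler0c !mulr_ge0 ?expR_ge0.
- move=> fe; rewrite gE flat_neg ?mulr0// subr_le0 ler_pdivrMl// mulr1.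
  exact: ltW.
rewrite gE [f x in leLHS]ge0_smooth_fun// -rmorphB lecR.
set s := complex.Re (f x); have [s2|s2] := leP (s - 2 * e) 0.
  by apply: le_trans s2 _; rewrite !mulr_ge0 ?expR_ge0 ?f0R.
(* Above [2 * e] the argument of [flat] is at least 1, so the two exponentials multiply to at least
   1 and the cut off value is at least [s]. *)
have s1 : 1 <= e^-1 * s - 1.
  by rewrite lerBrDr -(ler_pM2l e0) mulrA divff ?gt_eqF// mul1r; lra.
rewrite flat_pos; last by apply: lt_le_trans s1.
rewrite hornerC mul1r [s * _]mulrC mulrA -expRD.
apply: (@le_trans _ _ s); first by rewrite gerBl; lra.
rewrite ler_peMl ?f0R// -[leLHS]expR0 ler_expR subr_ge0 invf_le1//.
by apply: lt_le_trans s1.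
Qed.

Lemma smooth_fun_locally_finite_sum (F : nat -> smooth_fun M) :
  (forall x, exists N, \forall y \near x, forall i, (N <= i)%N -> F i y = 0) ->
  exists G : smooth_fun M, forall x, exists N, forall m, (N <= m)%N ->
    G x = \sum_(i < m) F i x.
Proof.
move=> locF; have [N NF] := choice locF.
(* The choice [N] need not be locally constant, but for [y] near [x] the sums up to [N y] and up to
   [m] differ only by zero terms. *)
have sumE m x : (N x <= m)%N -> \forall y \near x,
    \sum_(i < N y) F i y = (\sum_(i < m) F i) y.
  move=> Nm; have := NF x; apply: filterS => y Fy.
  have Fy' := nbhs_singleton (NF y).
  rewrite smooth_fun_sumE.
  have ext k l : (k <= l)%N -> (forall i, (k <= i)%N -> F i y = 0) ->
      \sum_(i < k) F i y = \sum_(i < l) F i y.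
    move=> kl Fk; rewrite -!(big_mkord xpredT (fun i => F i y)).
    rewrite (big_cat_nat (leq0n k) kl)//= [X in _ = _ + X]big_nat_cond.
    by rewrite [X in _ = _ + X]big1 ?addr0// => i /andP[/andP[ki _] _]; exact: Fk.
  have [Nym|mNy] := leqP (N y) m; first exact: ext.
  apply/esym/ext; first exact: ltnW.
  by move=> i mi; apply: Fy; exact: leq_trans mi.
have sG : is_smooth (fun x => \sum_(i < N x) F i x).
  have loc (p : R[i] -> R) (c : chart R n M) :
      (forall f, smooth_on (chart_cod c) (p \o (f \o chart_inv c))) ->
      smooth_on (chart_cod c) (p \o ((fun x => \sum_(i < N x) F i x) \o chart_inv c)).
    move=> sp k; apply: near_eq_Ck_on => y cy.
    exists (p \o ((\sum_(i < N (chart_inv c y)) F i) \o chart_inv c)); first exact: sp.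
    have ci := @chart_inv_continuous _ _ _ c y (mem_set cy).
    have near_y : \forall z \near y, \sum_(i < N (chart_inv c z)) F i (chart_inv c z) =
        (\sum_(i < N (chart_inv c y)) F i) (chart_inv c z).
      exact: ci _ (sumE _ _ (leqnn (N (chart_inv c y)))).
    by apply: filterS near_y => z /= ->.
  by move=> c Ac; split; apply: loc => f; [exact: rsmooth_Re|exact: rsmooth_Im].
exists (SmoothFun (asboolT sG)) => x; exists (N x) => m Nm.
by rewrite /= (nbhs_singleton (sumE m x Nm)) smooth_fun_sumE.
Qed.

Definition absf f x : R := complex.Re `|f x|.

Lemma absfE f x : `|f x| = (absf f x)%:C%C.
Proof. by rewrite /absf normc_def. Qed.

Lemma absf_ge0 f x : 0 <= absf f x.
Proof. by rewrite /absf normc_def/= sqrtr_ge0. Qed.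

Lemma absfM f g x : absf (f * g) x = absf f x * absf g x.
Proof.
by apply/(@complexI R); rewrite rmorphM/= -!absfE smooth_funME normrM.
Qed.

Lemma absf1 x : absf 1 x = 1.
Proof. by apply/(@complexI R); rewrite -absfE smooth_fun1E normr1. Qed.

Lemma absfN f x : absf (- f) x = absf f x.
Proof. by apply/(@complexI R); rewrite -!absfE smooth_funNE normrN. Qed.

Lemma absfX f m x : absf (f ^+ m) x = absf f x ^+ m.
Proof. by elim: m => [|m IH]; rewrite ?expr0 ?absf1// !exprS absfM IH. Qed.

Lemma absf_eq0 f x : f x = 0 -> absf f x = 0.
Proof. by rewrite /absf => ->; rewrite normr0. Qed.

Lemma Re_le_absf f x : complex.Re (f x) <= absf f x.
Proof.
rewrite -lecR -absfE; apply: le_trans (normc_ge_Re _).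
by rewrite lecR ler_norm.
Qed.

Lemma absf_continuous f : continuous (absf f).
Proof.
have -> : absf f = Num.sqrt \o (fun x => complex.Re ((smooth_conj f * f) x)).
  apply/funext => x; rewrite /absf normc_def /comp smooth_funME smooth_conjE.
  by case: (f x) => a b /=; rewrite mulNr opprK !expr2.
move=> x; apply: continuous_comp; last exact: sqrt_continuous.
exact/rsmooth_continuous/rsmooth_Re.
Qed.

(** Compactness bounds the continuous function [absf f] on [K], which makes the supremum an upper
    bound. *)
Lemma le_C0_seminorm (K : set M) f x : compact K -> K x -> absf f x <= C0_seminorm K f.
Proof.
move=> cK Kx; apply: ub_le_sup; last by exists x.
have [|c _ cP] := @compact_EVT_max _ _ (absf f) K (ex_intro _ x Kx) cK.
  exact/continuous_subspaceT/absf_continuous.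
by exists (absf f c) => _ [y Ky <-]; apply: cP; rewrite inE.
Qed.

Lemma C0_seminorm_le (K : set M) f (b : R) : 0 <= b ->
  (forall x, K x -> absf f x <= b) -> C0_seminorm K f <= b.
Proof.
move=> b0 Kb; rewrite /C0_seminorm.
have [->|/set0P[x Kx]] := eqVneq K set0; first by rewrite image_set0 sup0.
by apply: ge_sup; [exists (absf f x); exists x|move=> _ [y Ky <-]; exact: Kb].
Qed.

Lemma C0_seminorm_ge0 (K : set M) f : compact K -> 0 <= C0_seminorm K f.
Proof.
move=> cK; have [->|/set0P[x Kx]] := eqVneq K set0.
  by rewrite /C0_seminorm image_set0 sup0.
exact: le_trans (absf_ge0 f x) (le_C0_seminorm f cK Kx).
Qed.

Lemma C0_seminormS (K L : set M) f :
  compact L -> K `<=` L -> C0_seminorm K f <= C0_seminorm L f.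
Proof.
move=> cL KL; apply: C0_seminorm_le; first exact: C0_seminorm_ge0.
by move=> y /KL; exact: le_C0_seminorm.
Qed.

End SmoothCalculus.

(** * Topology of manifolds *)

Lemma countable_basis (T : topologicalType) : @second_countable T ->
  exists b : nat -> set T, forall x U, nbhs x U ->
    exists i, [/\ open (b i), b i x & b i `<=` U].
Proof.
move=> [B /countable_injP[k kinj] [Bo Bb]].
(* An injection [k] numbers the basis; an index outside its image gets the empty set. *)
exists (fun i => [set x | exists b, [/\ B b, k b = i & b x]]) => x U /(Bb x).
move=> [b [Bb' bx] bU]; exists (k b).
have -> : [set x | exists b', [/\ B b', k b' = k b & b' x]] = b.
  apply/seteqP; split=> [y [c [Bc kc cy]]|y ky]; last by exists b.
  by have <- : c = b by apply: kinj; rewrite ?inE.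
by split=> //; exact: Bo.
Qed.

Lemma dense_sequence (T : topologicalType) (Z : set T) : @second_countable T ->
  exists z : nat -> option T, (forall i x, z i = Some x -> Z x) /\
    forall x U, Z x -> nbhs x U -> exists i y, z i = Some y /\ U y.
Proof.
move=> /countable_basis[b bP].
(* One point of [Z] is picked in each basic set that meets [Z]; [None] stands for the others, and so
   also covers empty [Z]. *)
have /choice[z zP] i : exists o : option T, (forall x, o = Some x -> Z x) /\
    (b i `&` Z !=set0 -> exists2 y, o = Some y & b i y).
  have [[y [iy Zy]]|bZ] := pselect (b i `&` Z !=set0).
    by exists (Some y); split=> [x [<-]//|_]; exists y.
  by exists None; split=> // /bZ.
exists z; split=> [i x /(proj1 (zP i))//|x U Zx /bP[i [_ ix iU]]].
have [|y zy iy] := (zP i).2; first by exists x.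
by exists i, y; split=> //; exact: iU.
Qed.

Lemma compact_exhaustion (T : topologicalType) : @second_countable T ->
  (forall x : T, exists2 K, compact K & nbhs x K) ->
  exists K : nat -> set T, (forall i, compact (K i)) /\
    forall x : T, exists N, \forall y \near x, forall i, (N <= i)%N -> K i y.
Proof.
move=> /countable_basis[b bP] lcT.
(* Basic sets contained in a compact set are given a compact superset, the others the empty set. By
   local compactness the former cover the space. *)
have /choice[C CP] i : exists C, compact C /\
    forall K, compact K -> b i `<=` K -> b i `<=` C.
  have [[K [cK iK]]|noK] := pselect (exists K, compact K /\ b i `<=` K).
    by exists K.
  exists set0; split; first exact: compact0.
  by move=> K cK iK; exfalso; apply: noK; exists K.
exists (fun i => \big[setU/set0]_(j < i) C j); split=> [i|x].
  by apply: bigsetU_compact => j _; exact: (CP j).1.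
(* The index is [i.+1] because the union over [j < i.+1] is the first to contain [C i]. *)
have [K cK /bP[i [oi ix iK]]] := lcT x; exists i.+1.
have : nbhs x (b i) by apply: open_nbhs_nbhs.
apply: filterS => y iy j ij; rewrite -bigcup_mkord; exists i => //.
exact: (CP i).2 K cK iK y iy.
Qed.

Section ManifoldTopology.
Variables (R : realType) (n : nat) (M : smooth_manifold R n).
Implicit Types (f g h : smooth_fun M) (x y : M) (K : set M).

(** In a chart, a closed cube around the image of [x] is compact and lies in the chart codomain;
    [chart_inv] carries it to a compact neighbourhood. *)
Lemma manifold_locally_compact x : exists2 K, compact K & nbhs x K.
Proof.
have [c Ac cx] := manifold_atlas_cover x.
have cdo : open (chart_dom c) by exact: chart_dom_open.
have cco : open (chart_cod c) by exact: chart_cod_open.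
have : nbhs (chart_map c x) (chart_cod c).
  by apply: open_nbhs_nbhs; split=> //; exact: chart_map_fun.
move=> /nbhs_ballP[e /= e0 ballc].
pose A := [set v : 'rV[R]_n | forall i,
  `[chart_map c x 0 i - e / 2, chart_map c x 0 i + e / 2]%classic (v ord0 i)].
have cA : compact A.
  by apply: (@rV_compact _ _ (fun i => `[_, _]%classic)) => i; exact: segment_compact.
have Ac' : A `<=` chart_cod c.
  move=> v Av; apply: ballc; split=> // i j; rewrite (ord1 i).
  have := Av j; rewrite /= in_itv/= /ball/= ltr_distlC => /andP[? ?].
  by apply/andP; split; lra.
exists [set chart_inv c v | v in A].
  apply: continuous_compact => //; apply: continuous_in_subspaceT => v /set_mem Av.
  by apply: chart_inv_continuous; rewrite inE; exact: Ac'.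
have nball : nbhs (chart_map c x) (ball (chart_map c x) (e / 2)).
  by apply: nbhsx_ballx; rewrite divr_gt0.
have ndom : nbhs x (chart_dom c) by apply: open_nbhs_nbhs.
have cmx := @chart_map_continuous _ _ _ c x (mem_set cx).
have nmap : nbhs x (chart_map c @^-1` ball (chart_map c x) (e / 2)) by exact: cmx.
apply: filterS2 nmap ndom => y /= [_ by1] cy; exists (chart_map c y); last first.
  by rewrite chart_mapK// inE.
move=> i; have := by1 0 i; rewrite /= in_itv/= /ball/= ltr_distlC => /andP[? ?].
by apply/andP; split; exact: ltW.
Qed.

(** A finite family of compact sets can be replaced by its union, so a single seminorm suffices to
    test closedness. *)
Lemma closed_C0P (I : set (smooth_fun M)) : closed I <->
  forall f, (forall K e, compact K -> 0 < e ->
    exists2 g, I g & C0_seminorm K (g - f) < e) -> I f.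
Proof.
split=> [/closed_openC oI f fI|clI].
  apply: contrapT => nIf; have [F [e [finF cF e0 FI]]] := oI f nIf.
  have cU : compact (\bigcup_(K in F) K).
    move: finF => /finite_fsetP[F' FF']; rewrite FF' bigcup_fset.
    rewrite big_seq; apply: bigsetU_compact => K KF.
    by apply: cF; rewrite FF'.
  have [g Ig ge] := fI _ e cU e0; apply: (FI g) => // K FK.
  by apply: le_lt_trans ge; apply: C0_seminormS => //; exact: bigcup_sup.
rewrite -[I]setCK; apply: open_closedC; change (C0_open (~` I)) => f nIf.
apply: contrapT => nF; apply/nIf/clI => K e cK e0.
apply: contrapT => noG; apply: nF; exists [set K], e; split=> //.
- by move=> _ ->.
- by move=> g /(_ K erefl) ge Ig; apply: noG; exists g.
Qed.

End ManifoldTopology.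

(** * Closed *-ideals are vanishing ideals *)

Section VanishingIdeal.
Variables (R : realType) (n : nat) (M : smooth_manifold R n).
Implicit Types (f g h : smooth_fun M) (x y : M) (K : set M).

Section Ideal.
Variable I : set (smooth_fun M).
Hypothesis starI : star_ideal I.

Lemma star_idealZ (a : R[i]) f : I f -> I (a *: f).
Proof.
by move=> If; rewrite -[f]mul1r smooth_scalerAl; exact: star_idealM.
Qed.

Lemma star_ideal_bump x f : I f -> f x != 0 ->
  exists g, [/\ I g, forall y, 0 <= g y & 1 < complex.Re (g x)].
Proof.
move=> If fx0; have a0 : 0 < absf f x ^+ 2.
  rewrite exprn_gt0// lt_neqAle absf_ge0 andbT eq_sym.
  by apply: contra fx0 => /eqP a0; rewrite -normr_eq0 absfE a0.
(* A multiple of [|f|^2], scaled to take the value 2 at [x]. *)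
exists ((2 / absf f x ^+ 2)%:C%C *: (smooth_conj f * f)).
have gE y : ((2 / absf f x ^+ 2)%:C%C *: (smooth_conj f * f)) y =
    (2 / absf f x ^+ 2 * absf f y ^+ 2)%:C%C.
  by rewrite !smooth_funE [_ * f y]mulrC -sqr_normc absfE -rmorphXn -rmorphM.
split=> [|y|].
- by apply: star_idealZ; exact: (star_idealM starI).
- by rewrite gE ler0c mulr_ge0 ?divr_ge0 ?sqr_ge0.
by rewrite gE /= -mulrA mulVf ?gt_eqF// mulr1 ltr1n.
Qed.

Lemma star_ideal_dominate K f (e : R) : compact K -> 0 < e ->
  (forall x, (forall h, I h -> h x = 0) -> f x = 0) ->
  exists h, [/\ I h, forall y, 0 <= h y &
    forall y, K y -> absf f y < e \/ 1 < complex.Re (h y)].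
Proof.
move=> /compact_near_coveringP cK e0 f0.
(* Sums make [D] directed upwards, and [1 < h y] persists for larger [h]. Near-covering compactness
   along this filter therefore merges local bumps into one function. *)
pose D := [set h | I h /\ forall y, 0 <= h y].
pose up g := [set h | D h /\ forall y, g y <= h y].
pose F := filter_from D up.
have FF : Filter F.
  apply: filter_from_filter.
    by exists 0; split=> [|y]; [exact: star_ideal0|rewrite smooth_fun0E].
  move=> g h [Ig g0] [Ih h0]; exists (g + h).
    by split=> [|y]; [exact: star_idealD|rewrite smooth_funDE addr_ge0].
  by move=> u [Du ghu]; split; split=> // y; apply: le_trans (ghu y);
    rewrite smooth_funDE ?lerDl ?lerDr.
pose P h y := absf f y < e \/ 1 < complex.Re (h y).
have [x Kx|h Dh hK] := cK _ F P FF; last first.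
  exists h; split; [exact: Dh.1|exact: Dh.2|apply: hK].
  by split=> // y.
(* At a common zero of [I], [f] vanishes and is small nearby; elsewhere a bump exceeds 1 nearby, and
   so does everything above it. *)
have [Ix|] := pselect (forall h, I h -> h x = 0).
  exists ([set y | absf f y < e], setT); last by move=> [y h] [fy _]; left.
  split=> /=; last exact: filterT.
  apply: (@absf_continuous _ _ _ f x [set r | r < e]).
  apply: open_nbhs_nbhs; split; first exact: open_lt.
  by rewrite /= absf_eq0// f0.
move=> /existsNP[h /not_implyP[Ih /eqP hx]].
have [g [Ig g0 gx]] := star_ideal_bump Ih hx.
exists ([set y | 1 < complex.Re (g y)], up g); last first.
  move=> [y u] [/= gy [_ gu]]; right; apply: lt_le_trans gy _.
  by have := gu y; rewrite lecE => /andP[].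
split=> /=; last by exists g.
apply: (rsmooth_continuous (@rsmooth_Re _ _ _ g) (t := [set r | 1 < r])).
by apply: open_nbhs_nbhs; split; first exact: open_gt.
Qed.

Lemma star_ideal_approx K f (e : R) : compact K -> 0 < e ->
  (forall x, (forall h, I h -> h x = 0) -> f x = 0) ->
  exists2 g, I g & C0_seminorm K (g - f) < e.
Proof.
move=> cK e0 f0.
have [h [Ih h0 hK]] := star_ideal_dominate cK (divr_gt0 e0 (ltr0Sn R 1)) f0.
(* Adding 1 makes [C] positive even if [h] vanishes on [K], and keeps [1 - h / C] between 0 and 1 on
   [K]. *)
pose C := C0_seminorm K h + 1; pose B := C0_seminorm K f.
have C1 : 1 <= C by rewrite lerDr C0_seminorm_ge0.
have C0 : 0 < C by apply: lt_le_trans C1.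
pose p := 1 - (C^-1)%:C%C *: h.
have pE y : p y = (1 - C^-1 * complex.Re (h y))%:C%C.
  by rewrite !smooth_funE [h y in LHS]ge0_smooth_fun// rmorphB rmorphM.
have pK y : K y -> absf p y = 1 - C^-1 * complex.Re (h y).
  move=> Ky; apply: (@complexI R); rewrite -absfE pE ger0_norm// ler0c.
  rewrite subr_ge0 ler_pdivrMl// mulr1 (le_trans (Re_le_absf _ _))//.
  by rewrite (le_trans (le_C0_seminorm h cK Ky))// lerDl.
pose q := 1 - C^-1.
have q0 : 0 <= q by rewrite subr_ge0 invf_le1.
have B0 : 0 <= B by exact: C0_seminorm_ge0.
have eB : 0 < e / 2 / (B + 1) by rewrite !divr_gt0// ltr_wpDl.
have [m qm] : exists m, B * q ^+ m < e / 2.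
  have /cvgrPdist_lt/(_ (e / 2 / (B + 1))) : q ^+ m @[m --> \oo] --> (0 : R).
    by apply: cvg_expr; rewrite ger0_norm// ltrBlDr ltrDl invr_gt0.
  move=> /(_ eB)[m _ /(_ m (leqnn m))] /=; rewrite sub0r normrN ger0_norm ?exprn_ge0//.
  rewrite ltr_pdivlMr ?ltr_wpDl// => qm; exists m; apply: le_lt_trans qm.
  by rewrite mulrC ler_wpM2l ?exprn_ge0// lerDl.
(* Telescoping: passing from [p ^+ k] to [p ^+ k.+1] adds [f * p ^+ k * h / C], a multiple of
   [h]. *)
have Ip k : I (f - f * p ^+ k).
  elim: k => [|k IHk]; first by rewrite expr0 mulr1 subrr; exact: star_ideal0.
  have -> : f - f * p ^+ k.+1 = (f - f * p ^+ k) + (f * p ^+ k) * ((C^-1)%:C%C *: h).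
    by rewrite exprSr mulrA {2}/p mulrBr mulr1 opprB addrA addrAC.
  by apply: (star_idealD starI) => //; apply: (star_idealM starI); exact: star_idealZ.
exists (f - f * p ^+ m) => //.
have e2 : e / 2 < e by rewrite ltr_pdivrMr// ltr_pMr// ltr1n.
apply: le_lt_trans e2; apply: C0_seminorm_le => [|y Ky]; first by rewrite divr_ge0// ltW.
rewrite addrAC subrr sub0r absfN absfM absfX pK//.
have py0 : 0 <= 1 - C^-1 * complex.Re (h y) by rewrite -pK// absf_ge0.
have hy0 : 0 <= complex.Re (h y) by have := h0 y; rewrite lecE => /andP[].
(* Either [|f| < e / 2] and the power is at most 1, or [h > 1], so that [p <= q] and the product is
   at most [B * q ^+ m]. *)
have [fy|hy] := hK y Ky.
  apply: le_trans (ltW fy); rewrite ler_piMr ?absf_ge0//.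
  by rewrite exprn_ile1// lerBlDr lerDl mulr_ge0// invr_ge0 ltW.
apply: le_trans (ltW qm); apply: ler_pM => //; first exact: absf_ge0.
- exact: exprn_ge0.
- exact: le_C0_seminorm.
apply: lerXn2r; rewrite ?nnegrE//.
by rewrite lerD2l lerN2 ler_peMr ?invr_ge0 ?(ltW C0) ?(ltW hy).
Qed.

Lemma closed_star_idealE : closed I ->
  I = [set f | forall x, (forall h, I h -> h x = 0) -> f x = 0].
Proof.
move=> /closed_C0P clI; apply/seteqP; split=> [f If x|f f0]; first exact.
by apply: clI => K e cK e0; exact: star_ideal_approx.
Qed.

End Ideal.
End VanishingIdeal.

(** * Vanishing ideals are kernels *)

(* Polynomials encode the finitely supported sequences. *)
Section PolyPreHilbert.
Variable R : realType.
Notation H := {poly R[i]}.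
Implicit Types p q : H.

Definition poly_dot p q : R[i] := \sum_(k < size p) p`_k * (q`_k)^*%C.

(** Allows polynomials of different sizes to share one summation range. *)
Lemma poly_dotE m p q : (size p <= m)%N ->
  poly_dot p q = \sum_(k < m) p`_k * (q`_k)^*%C.
Proof.
move=> pm; rewrite /poly_dot.
rewrite -!(big_mkord xpredT (fun k => p`_k * (q`_k)^*%C)).
rewrite [RHS](big_cat_nat (leq0n _) pm)/= [X in _ = _ + X]big_nat_cond.
rewrite [X in _ = _ + X]big1 ?addr0// => k /andP[/andP[pk _] _].
by rewrite nth_default// mul0r.
Qed.

Lemma poly_dot_linearl q a p p' :
  poly_dot (a *: p + p') q = a * poly_dot p q + poly_dot p' q.
Proof.
pose m := maxn (size (a *: p + p')) (maxn (size p) (size p')).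
rewrite !(@poly_dotE m) ?leq_max ?leqnn ?orbT//.
rewrite mulr_sumr -big_split/=; apply: eq_bigr => k _.
by rewrite coefD coefZ mulrDl mulrA.
Qed.

Lemma poly_dot_linearr p a q q' :
  poly_dot p (a *: q + q') = a^*%C * poly_dot p q + poly_dot p q'.
Proof.
rewrite /poly_dot mulr_sumr -big_split/=; apply: eq_bigr => k _.
by rewrite coefD coefZ (rmorphD (@conjc R)) (rmorphM (@conjc R)) mulrDr mulrCA.
Qed.

Lemma poly_dot_bilinear :
  bilinear_for *%R (@conjc R \; *%R) (poly_dot : H -> H -> R[i]).
Proof. by split=> [q a p p'|p a q q']; [exact: poly_dot_linearl|exact: poly_dot_linearr]. Qed.

HB.instance Definition _ := bilinear_isBilinear.Build R[i] H H R[i]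
  *%R (@conjc R \; *%R) poly_dot poly_dot_bilinear.

Lemma poly_dot_hermitian p q :
  poly_dot p q = (-1) ^+ false * (poly_dot q p)^*%C.
Proof.
rewrite expr0 mul1r !(@poly_dotE (maxn (size p) (size q))) ?leq_maxl ?leq_maxr//.
by rewrite rmorph_sum; apply: eq_bigr => k _; rewrite rmorphM/= conjcK mulrC.
Qed.

HB.instance Definition _ := isHermitianSesquilinear.Build R[i] H false (@conjc R)
  poly_dot poly_dot_hermitian.

(** All terms are nonnegative and that of the leading coefficient is positive. *)
Lemma poly_dot_gt0 p : p != 0 -> 0 < poly_dot p p.
Proof.
move=> p0; rewrite /poly_dot.
have [m sp] : exists m, size p = m.+1.
  by exists (size p).-1; rewrite prednK ?size_poly_gt0.
rewrite sp big_ord_recr/= ltr_wpDl//.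
  by apply: sumr_ge0 => k _; rewrite -sqr_normc exprn_ge0.
rewrite -sqr_normc exprn_gt0// normr_gt0.
by have := p0; rewrite -lead_coef_eq0 lead_coefE sp.
Qed.

HB.instance Definition _ := isDotProduct.Build R[i] H poly_dot poly_dot_gt0.

End PolyPreHilbert.

Section PointRepresentation.
Variables (R : realType) (n : nat) (M : smooth_manifold R n).
Implicit Types (f g : smooth_fun M).

Lemma star_rep_kernel_zeros (Z : set M) :
  star_rep_kernel [set f : smooth_fun M | forall x, Z x -> f x = 0].
Proof.
have [z [zZ zdense]] := dense_sequence Z (manifold_second_countable M).
(* The weight of the i-th coordinate is the value of [f] at [z i]. Coordinates without a point get
   weight 0, hence put no condition on the kernel. *)
pose w i f : R[i] := if z i is Some x then f x else 0.
have wlin i (a : R[i]) f g : w i (a *: f + g) = a * w i f + w i g.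
  by rewrite /w; case: (z i) => [x|]; rewrite ?smooth_funE// mulr0 addr0.
have wM i f g : w i (f * g) = w i f * w i g.
  by rewrite /w; case: (z i) => [x|]; rewrite ?mul0r.
have wC i f : w i (smooth_conj f) = (w i f)^*%C.
  by rewrite /w; case: (z i) => [x|]; rewrite ?smooth_conjE// rmorph0.
pose op f (p : {poly R[i]}) := \poly_(i < size p) (w i f * p`_i).
have opE f p i : (op f p)`_i = w i f * p`_i.
  by rewrite coef_poly; case: ltnP => // pi; rewrite nth_default// mulr0.
have op_adj f : is_adjoint (@poly_dot R) (op f) (op (smooth_conj f)).
  move=> p q; change (poly_dot (op f p) q = poly_dot p (op (smooth_conj f) q)).
  rewrite (@poly_dotE _ (size p)) ?size_poly// /poly_dot.
  apply: eq_bigr => k _.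
  by rewrite !opE wC rmorphM/= conjcK mulrCA mulrA.
have op_lin f : linear (op f).
  by move=> a p q; apply/polyP => i; rewrite !(coefD, coefZ, opE) mulrDr mulrCA.
exists {poly R[i]}, (@poly_dot R), op; split.
- split=> [f|a f g|f g|f].
  + by split=> //; exists (op (smooth_conj f)).
  + apply/funext => p; apply/polyP => i.
    rewrite [RHS]coefD [X in _ = X + _]coefZ.
    by rewrite !opE wlin mulrDl mulrA.
  + by apply/funext => p; apply/polyP => i; rewrite /= !opE wM mulrA.
  + exact: op_adj.
apply/seteqP; split=> f /= f0.
  apply/funext => p; apply/polyP => i; rewrite opE coef0 /w.
  by case zi: (z i) => [x|]; rewrite ?mul0r// f0 ?mul0r//; exact: zZ zi.
(* Applying the operator to the basis vector ['X^i] isolates the i-th weight. *)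
have wf0 i : w i f = 0.
  have : (op f 'X^i)`_i = 0 by rewrite f0 coef0.
  by rewrite opE coefXn eqxx mulr1.
(* If [f x] were nonzero, [f] would be nonzero on a neighbourhood of [x], which contains some
   [z i]. *)
move=> x Zx; apply: contrapT => /eqP fx.
have : nbhs x [set y | 0 < absf f y].
  apply: (@absf_continuous _ _ _ f x [set r | 0 < r]).
  apply: open_nbhs_nbhs; split; first exact: open_gt.
  by rewrite /= -ltcR -absfE normr_gt0.
move=> /(zdense x _ Zx)[i [y [zy]]] /=; have := wf0 i; rewrite /w zy => fy.
by rewrite absf_eq0// ltxx.
Qed.

End PointRepresentation.

(** * Kernels are closed *)

Section PositiveFunctional.
Variables (R : realType) (n : nat) (M : smooth_manifold R n).
Implicit Types (f g h : smooth_fun M) (x y : M) (K : set M).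
Variable w : smooth_fun M -> R[i].
Hypothesis wlin : forall (a : R[i]) f g, w (a *: f + g) = a * w f + w g.
Hypothesis w_sqr_ge0 : forall f, 0 <= w (smooth_conj f * f).

Let wD f g : w (f + g) = w f + w g.
Proof. by rewrite -[f]scale1r wlin mul1r scale1r. Qed.

Let w0 : w 0 = 0.
Proof. by apply: (addIr (w 0)); rewrite -wD !add0r. Qed.

Let wZ (a : R[i]) f : w (a *: f) = a * w f.
Proof. by rewrite -[a *: f]addr0 wlin w0 addr0. Qed.

Let wB f g : w (f - g) = w f - w g.
Proof. by rewrite wD -scaleN1r wZ mulN1r. Qed.

Let w_sum m (F : nat -> smooth_fun M) :
  w (\sum_(i < m) F i) = \sum_(i < m) w (F i).
Proof. exact: (big_morph w wD w0). Qed.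

Let w1_ge0 : 0 <= w 1.
Proof.
have -> : (1 : smooth_fun M) = smooth_conj 1 * 1.
  by apply: smooth_fun_ext => x; rewrite !smooth_funE mulr1 rmorph1.
exact: w_sqr_ge0.
Qed.

(* A nonnegative function need not be the square of a smooth function, but it
   becomes one after adding a positive constant. *)
Lemma positive_functional_ge0 f : (forall x, 0 <= f x) -> 0 <= w f.
Proof.
move=> f0; have wfe (e : R) : 0 < e -> 0 <= e%:C%C * w 1 + w f.
  move=> e0; rewrite -wlin.
  have [|g ->] := smooth_fun_sqrt (f := e%:C%C *: (1 : smooth_fun M) + f).
    by move=> x; rewrite !smooth_funE mulr1 ltr_pwDl// ltcR.
  exact: w_sqr_ge0.
have w1E : w 1 = (complex.Re (w 1))%:C%C.
  by move: w1_ge0 => /ger0_Im; case: (w 1) => a b /= ->.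
have w1R : 0 <= complex.Re (w 1) by have := w1_ge0; rewrite lecE => /andP[].
(* Nonnegativity in [R[i]] includes being real, so a single [e] already shows that [w f] is real. *)
have wRe (e : R) : 0 < e -> (complex.Im (w f) == 0) &&
    (0 <= e * complex.Re (w 1) + complex.Re (w f)).
  move=> e0; have := wfe e e0; rewrite w1E -rmorphM lecE/=.
  by case: (w f) => a b /=; rewrite add0r.
rewrite lecE/=; have /andP[-> _] := wRe 1 ltr01; rewrite /=.
rewrite leNgt; apply/negP => wf0.
(* With this [e], [e * (w 1 + 1) = - w f / 2], so [e * w 1 + w f] would be negative. *)
pose e := - complex.Re (w f) / (2 * (complex.Re (w 1) + 1)).
have den : 0 < 2 * (complex.Re (w 1) + 1) by rewrite mulr_gt0// ltr_wpDl.
have e0 : 0 < e by rewrite divr_gt0// oppr_gt0.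
have /andP[_] := wRe e e0; rewrite leNgt => /negP; apply.
have : e * (2 * (complex.Re (w 1) + 1)) = - complex.Re (w f).
  by rewrite /e divfK// gt_eqF.
move: w1R e0 wf0; set a := complex.Re (w 1); set b := complex.Re (w f).
move: e => e a0 e0 b0 eE.
have ea : 0 <= e * a by rewrite mulr_ge0// ltW.
by lra.
Qed.

Lemma positive_functional_le f g : (forall x, f x <= g x) -> w f <= w g.
Proof.
move=> fg; rewrite -subr_ge0 -wB; apply: positive_functional_ge0 => x.
by rewrite !smooth_funE subr_ge0.
Qed.

(* Otherwise a locally finite sum of cut off witnesses would be a smooth
   function of infinite w-value. *)
Lemma positive_functional_compact : exists K e, [/\ compact K, 0 < e &
  forall f, (forall x, 0 <= f x) -> (forall x, K x -> complex.Re (f x) < e) ->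
    complex.Re (w f) <= 1].
Proof.
have [K [cK Kexh]] := compact_exhaustion (manifold_second_countable M)
  (@manifold_locally_compact _ _ M).
have w1R : 0 <= complex.Re (w 1) by have := w1_ge0; rewrite lecE => /andP[].
(* Cutting off at [e] costs at most [2 * e * w 1 <= 1 / 2], so witnesses of value above 1 keep at
   least [1 / 2]. *)
pose e := (4 * (complex.Re (w 1) + 1))^-1.
have den : 0 < 4 * (complex.Re (w 1) + 1) by rewrite mulr_gt0// ltr_wpDl.
have e0 : 0 < e by rewrite invr_gt0.
have e1 : 2 * e * complex.Re (w 1) <= 2^-1.
  have : e * (4 * (complex.Re (w 1) + 1)) = 1 by rewrite mulVf// gt_eqF.
  by move: e0; move: (e) => {}e e0 eE; lra.
apply: contrapT => noK.
have /choice[f fP] i : exists f, [/\ forall x, 0 <= f x,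
    forall x, K i x -> complex.Re (f x) < e & 1 < complex.Re (w f)].
  apply: contrapT => nof; apply: noK; exists (K i), e; split=> // f f0 fe.
  by rewrite leNgt; apply/negP => wf1; apply: nof; exists f.
have /choice[F FP] i : exists F : smooth_fun M, [/\ forall x, 0 <= F x,
    forall x, K i x -> F x = 0 & forall x, f i x - (2 * e)%:C%C <= F x].
  have [f0 fe _] := fP i; have [F [F0 Fz Fge]] := smooth_fun_cutoff e0 f0.
  by exists F; split=> // x /fe; exact: Fz.
have [|G GP] := @smooth_fun_locally_finite_sum _ _ _ F.
  move=> x; have [N KN] := Kexh x; exists N; apply: filterS KN => y Ky i Ni.
  by have [_ + _] := FP i; apply; exact: Ky.
have wF i : 2^-1 <= complex.Re (w (F i)).
  have [_ _ wf1] := fP i; have [_ _ Fge] := FP i.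
  have : w (f i - (2 * e)%:C%C *: (1 : smooth_fun M)) <= w (F i).
    by apply: positive_functional_le => x; rewrite !smooth_funE mulr1.
  rewrite wB wZ lecE => /andP[_]; apply: le_trans.
  have -> : complex.Re (w (f i) - (2 * e)%:C%C * w 1) =
      complex.Re (w (f i)) - 2 * e * complex.Re (w 1).
    by case: (w (f i)) => a b; case: (w 1) => c d /=; rewrite mul0r subr0.
  by move: wf1 e1; set s := 2 * e * _; lra.
have wG m : m%:R / 2 <= complex.Re (w G).
  have : w (\sum_(i < m) F i) <= w G.
    apply: positive_functional_le => x; have [N GN] := GP x.
    (* At each point [G] equals a partial sum of length at least [m], whose additional terms are
       nonnegative. *)
    rewrite (GN (maxn N m)) ?leq_maxl// smooth_fun_sumE.
    rewrite -!(big_mkord xpredT (fun i => F i x)).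
    rewrite (big_cat_nat (leq0n m) (leq_maxr N m))/= lerDl.
    by apply: sumr_ge0 => i _; have [] := FP i.
  rewrite w_sum lecE => /andP[_]; apply: le_trans.
  rewrite (big_morph (@complex.Re R) (raddfD _) (raddf0 _)).
  have -> : m%:R / 2 = \sum_(i < m) 2^-1 :> R.
    by rewrite sumr_const card_ord mulr_natl.
  by apply: ler_sum => i _; exact: wF.
have wG0 : 0 <= 2 * complex.Re (w G).
  by rewrite mulr_ge0//; apply: le_trans (wG 0); rewrite mul0r.
by have := archi_boundP wG0; have := wG (Num.bound (2 * complex.Re (w G))); lra.
Qed.

End PositiveFunctional.

Section RepresentationKernel.
Variables (R : realType) (n : nat) (M : smooth_manifold R n).

Lemma star_rep_kernel_closed (H : lmodType R[i]) (dot : {dot H for @conjc R})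
    (op : smooth_fun M -> H -> H) :
  star_rep dot op -> closed [set f | op f = 0].
Proof.
move=> [_ op_lin opM op_conj]; apply/closed_C0P => f approx.
apply/funext => v; apply: contrapT => /eqP fv0.
pose w g := dot (op g v) v.
have wlin (a : R[i]) g h : w (a *: g + h) = a * w g + w h.
  by rewrite /w op_lin linearPl.
have wsqr g : w (smooth_conj g * g) = dot (op g v) (op g v).
  rewrite /w opM /= op_conj; congr (dot _ (op _ _)).
  by apply: smooth_fun_ext => x; rewrite !smooth_funE conjcK.
have dot_gt0 u : u != 0 -> 0 < dot u u by exact: neq0_dnorm_gt0.
have wpos g : 0 <= w (smooth_conj g * g).
  rewrite wsqr; have [->|/dot_gt0/ltW//] := eqVneq (op g v) 0.
  by rewrite linear0l.
have dotNN u : dot (- u) (- u) = dot u u.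
  by rewrite linearNl linearNr opprK.
have [K [e [cK e0 we]]] := positive_functional_compact wlin wpos.
set a := complex.Re (dot (op f v) (op f v)).
have a0 : 0 < a by have := dot_gt0 _ fv0; rewrite ltcE => /andP[].
(* On [K], [|h| < 1] gives [|h|^2 <= |h| < e / (2 / a)], hence [u < e] there and [w u <= 1]. *)
have d0 : 0 < Num.min 1 (e / (2 / a)) by rewrite lt_min ltr01 !divr_gt0.
have [g /= g0 gf] := approx K _ cK d0.
(* The factor [2 / a] is chosen to make [w u = 2], since [op g v = 0] gives [w (|h|^2) = a]. *)
pose h := g - f; pose u := (2 / a)%:C%C *: (smooth_conj h * h).
have uE x : u x = (2 / a * absf h x ^+ 2)%:C%C.
  by rewrite !smooth_funE [_ * h x]mulrC -sqr_normc absfE -rmorphXn -rmorphM.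
have : complex.Re (w u) <= 1.
  apply: we => x; first by rewrite uE ler0c mulr_ge0 ?sqr_ge0// divr_ge0// ltW.
  move=> Kx; rewrite uE /= -ltr_pdivlMl ?divr_gt0//.
  have := le_lt_trans (le_C0_seminorm h cK Kx) gf; rewrite lt_min => /andP[h1 he].
  rewrite mulrC; apply: le_lt_trans he; rewrite expr2 ler_piMr ?absf_ge0//.
  exact: ltW.
have hv : op h v = - op f v.
  have -> : h = (- 1) *: f + g by rewrite scaleN1r addrC.
  by rewrite op_lin g0 addr0 /= scaleN1r.
have u0 : w u = (2 / a)%:C%C * dot (op f v) (op f v).
  have w0 : w 0 = 0 by rewrite /w; have := wlin (-1) 0 0; rewrite scaleN1r addr0
    oppr0 mulN1r addNr.
  by rewrite -[u]addr0 wlin w0 addr0 wsqr hv dotNN.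
have dotE : dot (op f v) (op f v) = a%:C%C.
  rewrite /a; have := dot_gt0 _ fv0.
  by move=> /ltW/ger0_Im; case: (dot _ _) => b c /= ->.
by rewrite u0 dotE -rmorphM/= divfK ?gt_eqF// leNgt ltr1n.
Qed.

End RepresentationKernel.

Theorem corollary6p2 (R : realType) (n : nat) (M : smooth_manifold R n)
    (I : set (smooth_fun M)) :
  star_ideal I -> (star_rep_kernel I <-> closed I).
Proof.
move=> starI; split=> [[H [dot [op [repH ->]]]]|clI].
  exact: star_rep_kernel_closed repH.
rewrite (closed_star_idealE starI clI); exact: star_rep_kernel_zeros.
Qed.
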